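(* Let $n \geq 3$, $m_i \geq 3$ for all $1 \leq i \leq n$, and $G = K_{m_1} \square \cdots \square K_{m_n}$. If $C \subseteq V(G)$ is a group identifying code in $G$, then $|J_C(u)| \neq 2$ for every $u \in V(G)$, and $|J_C(u)| \geq 3$ for every $u \in V(G) \setminus C$.
   Context: $G$ is the Hamming graph with vertex set $\mathbb{Z}_{m_1} \times \cdots \times \mathbb{Z}_{m_n}$, a group under componentwise modular addition, two vertices adjacent iff they differ in exactly one coordinate. For $C \subseteq V(G)$, $J_C(v) = N[v] \cap C$ with $N[v]$ the closed neighborhood. $C$ is an identifying code if the sets $J_C(v)$, $v \in V(G)$, are all nonempty and pairwise distinct; a group identifying code is an identifying code that is a subgroup of $V(G)$. *)

(* Defs.v *)
From HB Require Import structures.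
From mathcomp Require Import all_boot all_order all_fingroup all_algebra.

Set Implicit Arguments.
Unset Strict Implicit.
Unset Printing Implicit Defensive.

Section Codes.
Variables (T : finType) (e : rel T).

Definition closed_nbhd (v : T) : {set T} := [set u | (u == v) || e v u].

Definition codeJ (C : {set T}) (v : T) : {set T} := closed_nbhd v :&: C.

Definition identifying_code (C : {set T}) : Prop :=
  (forall v, codeJ C v != set0) /\ injective (codeJ C).

End Codes.

(* 'Z_k is the ring of integers mod k only for k > 1. The finGroupType
   structure on this type is the direct product of the additive groups: its
   law, written multiplicatively, is componentwise addition (see hammingM). *)
Definition hammingV (n : nat) (m : 'I_n -> nat) : finGroupType :=
  {dffun forall i : 'I_n, 'Z_(m i)}.

Definition hamming_adj (n : nat) (m : 'I_n -> nat) : rel (hammingV m) :=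
  fun u v => #|[set i | u i != v i]| == 1.

Definition group_identifying_code (n : nat) (m : 'I_n -> nat)
    (C : {set hammingV m}) : Prop :=
  group_set C /\ identifying_code (@hamming_adj n m) C.

Lemma hammingM (n : nat) (m : 'I_n -> nat) (u v : hammingV m) (i : 'I_n) :
  (u * v)%g i = (u i + v i)%R.
Proof. by rewrite ffunE. Qed.

(* Main.v *)
Require Import Defs.
From mathcomp Require Import all_boot all_order all_fingroup all_algebra.

(** Write the group additively. For [k] in [C], the reflection [v |-> k - v]
    preserves adjacency and [C], so [J (k - u) = k - J u].

    If [J u = {a, b}] with [a <> b], the reflection in [a + b] fixes [J u],
    hence [2u = a + b]. Then [2a - b = a + 2(a - u)] differs from [u] only where
    [a] does, so it lies in [J u] and must be [b]; the reflection in [2a] then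
    fixes [J u] as well, so [2u = 2a] and [a = b].

    If [J u = {a}] with [u <> a], translate to [a = 0]: reflection in [0] gives
    [2u = 0], and [u = x e_i] with [x <> 0]. Since [m_i > 2], [e_i <> u], so
    [J e_i] contains some [c <> 0]. The multiple [x c] differs from
    [u = x e_i] only where [c] differs from [e_i], so [x c] lies in
    [J u = {0}]. Thus [c_i <> 1], so [c] is supported on [i], hence [c] lies in
    [J u], a contradiction. *)

Set Implicit Arguments.
Unset Strict Implicit.
Unset Printing Implicit Defensive.

Import GRing.Theory.
Local Open Scope group_scope.

Section HammingGroupCode.
Variables (n : nat) (m : 'I_n -> nat).
Implicit Types (u v w k : hammingV m) (i j : 'I_n).

Lemma hamming1 i : (1 : hammingV m) i = 0%R.
Proof. by rewrite ffunE. Qed.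

Lemma hamming_inv u i : (u^-1) i = (- u i)%R.
Proof. by rewrite ffunE. Qed.

Lemma hammingX u p i : (u ^+ p) i = (u i *+ p)%R.
Proof.
elim: p => [|p IHp]; first by rewrite expg0 hamming1 mulr0n.
by rewrite expgS hammingM IHp mulrS.
Qed.

Lemma hamming_mulC u v : u * v = v * u.
Proof. by apply/ffunP => i; rewrite !hammingM addrC. Qed.

(** Serves to compute reflections: that in [a * b] swaps [a] and [b], that in [a * a] fixes [a]. *)
Lemma divg_eq_factor (gT : finGroupType) (k w w' v : gT) : k = w * w' ->
  (k * v^-1 == w) = (v == w').
Proof.
by move=> ->; rewrite -(can_eq (mulgK v)) mulgKV (inj_eq (mulgI w)) eq_sym.
Qed.

Definition hamming_diff u v : {set 'I_n} := [set i | u i != v i].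

Lemma in_codeJ (C : {set hammingV m}) u v :
  (v \in codeJ (@hamming_adj n m) C u)
    = (#|hamming_diff u v| <= 1) && (v \in C).
Proof.
rewrite !inE; congr (_ && _).
rewrite leq_eqVlt orbC ltnS leqn0 cards_eq0; congr (_ || _).
apply/eqP/eqP => [->|d0]; first by apply/setP => i; rewrite !inE eqxx.
apply/ffunP => i; apply/eqP; move/setP/(_ i): d0.
by rewrite !inE eq_sym => /negbFE.
Qed.

(** For a codeword, lying in [J u] only bounds the number of coordinates differing from [u], so it
    survives when these become fewer. *)
Lemma codeJ_diff_sub (C : {set hammingV m}) u u' v v' :
  (forall i, u' i = v' i -> u i = v i) ->
  v' \in codeJ (@hamming_adj n m) C u' -> v \in C ->
  v \in codeJ (@hamming_adj n m) C u.
Proof.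
move=> sub; rewrite !in_codeJ => /andP[le1 _] ->; rewrite andbT.
apply: leq_trans le1; apply/subset_leq_card/subsetP => i.
by rewrite !inE; apply: contraNN => /eqP/sub/eqP.
Qed.

Variable C : {group hammingV m}.
Local Notation J := (codeJ (@hamming_adj n m) C).

Lemma codeJ_sub u v : v \in J u -> v \in C.
Proof. by rewrite in_codeJ => /andP[]. Qed.

Lemma codeJ_reflect k u v : k \in C ->
  (v \in J (k * u^-1)) = (k * v^-1 \in J u).
Proof.
move=> Ck; rewrite !in_codeJ groupMl // groupV; congr (_ && _).
suff -> : hamming_diff (k * u^-1) v = hamming_diff u (k * v^-1) by [].
apply/setP => i; rewrite !inE !hammingM !hamming_inv; congr (~~ _).
by rewrite subr_eq [RHS]eq_sym subr_eq [in RHS]addrC.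
Qed.

Lemma codeJ_translate k u v : k \in C ->
  (v \in J (k * u)) = (k^-1 * v \in J u).
Proof.
move=> Ck; rewrite !in_codeJ groupMl ?groupV //; congr (_ && _).
suff -> : hamming_diff (k * u) v = hamming_diff u (k^-1 * v) by [].
apply/setP => i; rewrite !inE !hammingM hamming_inv; congr (~~ _).
by rewrite [RHS]eq_sym [(- _ + _)%R]addrC subr_eq addrC eq_sym.
Qed.

Hypothesis Jinj : injective J.

(** [k - u] and [u] have the same [J], so injectivity gives [k - u = u]. *)
Lemma codeJ_reflect_fix k u : k \in C ->
  (forall v, (v \in J u) = (k * v^-1 \in J u)) -> u * u = k.
Proof.
move=> Ck Jk; suff {1}<- : k * u^-1 = u by rewrite mulgKV.
by apply: Jinj; apply/setP => v; rewrite codeJ_reflect // -Jk.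
Qed.

Lemma codeJ_neq2 u : #|J u| <> 2.
Proof.
move=> /eqP/cards2P[a [b [neq_ab Ju]]].
have Ca : a \in C by apply: (@codeJ_sub u); rewrite Ju !inE eqxx.
have Cb : b \in C by apply: (@codeJ_sub u); rewrite Ju !inE eqxx orbT.
have uu : u * u = a * b.
  apply: codeJ_reflect_fix => [|v]; first exact: groupM.
  rewrite Ju !inE (@divg_eq_factor _ _ a b) // orbC.
  by rewrite (@divg_eq_factor _ _ b a) // hamming_mulC.
have aab : a * a * b^-1 = b.
  have: a * a * b^-1 \in J u.
    apply: (@codeJ_diff_sub _ _ u _ a); last by rewrite !groupM ?groupV.
      (* Where [u] agrees with [a], [2u = a + b] gives [b] the same value, hence [2a - b] too. *)
      move=> i eq_i; move/ffunP/(_ i): uu.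
      by rewrite !hammingM hamming_inv -eq_i => /addrI <-; rewrite addrK.
    by rewrite Ju !inE eqxx.
  by rewrite Ju !inE (@divg_eq_factor _ _ a a) // eq_sym (negbTE neq_ab) => /eqP.
have uu2 : u * u = a * a.
  apply: codeJ_reflect_fix => [|v]; first exact: groupM.
  rewrite Ju !inE (@divg_eq_factor _ _ a a) // (@divg_eq_factor _ _ b b) //.
  (* What remains is [a * a = b * b], that is, [aab] multiplied by [b]. *)
  by rewrite -[X in _ = X * _]aab mulgKV.
by move/eqP: uu; rewrite uu2 (inj_eq (mulgI a)) (negbTE neq_ab).
Qed.

Hypothesis m_gt2 : forall i, 2 < m i.

Lemma codeJ_eq1 u : J u = [set 1] -> u = 1.
Proof.
move=> Ju; have J1 : 1 \in J u by rewrite Ju set11.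
have uu : u * u = 1.
  apply: codeJ_reflect_fix => // v.
  by rewrite Ju !inE mul1g invg_eq1.
apply/eqP/negPn/negP => u_neq1.
have [i u_i] : exists i, u i != 0%R.
  apply/existsP; apply: contraNT u_neq1; rewrite negb_exists => /forallP u0.
  by apply/eqP/ffunP => i; rewrite hamming1; apply/eqP/negbNE.
have u_off j : j != i -> u j = 0%R.
  move: J1; rewrite in_codeJ => /andP[/card_le1_eqP le1 _].
  apply: contraNeq => u_j.
  by apply/eqP/le1; rewrite inE hamming1.
pose e : hammingV m := [ffun j => ((j == i)%:R)%R].
have eE j : e j = ((j == i)%:R)%R by rewrite ffunE.
(* The natural representative of the residue [u i] turns the multiple [x e_i] into the power
   [e ^+ x]. *)
pose x : nat := u i.
have eX : e ^+ x = u.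
  apply/ffunP => j; rewrite hammingX eE; have [->|ji] := eqVneq j i.
    exact: natr_Zp.
  by rewrite mul0rn u_off.
have neq_eu : e != u.
  (* Otherwise [u * u = 1] reads [1 + 1 = 0] at [i], impossible modulo [m i > 2]. *)
  apply/eqP => eu; move/ffunP/(_ i): uu; rewrite -eu hammingM eE eqxx hamming1.
  move/(congr1 val) => /=; case: (m i) (m_gt2 i) => [|[|[|q]]] //= _.
have J1e : 1 \in J e.
  rewrite in_codeJ group1 andbT; apply/card_le1_eqP => j k.
  rewrite !inE !eE !hamming1.
  by case: (eqVneq j i) => [->|_]; case: (eqVneq k i) => [->|_];
    rewrite ?eqxx.
(* If [1] were alone in [J e], then [J e = J u], against [neq_eu]. *)
have [c Jc c_neq1] : exists2 c, c \in J e & c != 1.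
  apply/exists_inP; apply: contraNT neq_eu => /exists_inPn Je1.
  apply/eqP/Jinj; rewrite Ju; apply/setP => v; rewrite in_set1.
  by apply/idP/eqP => [/Je1/negbNE/eqP|->].
have Cc := codeJ_sub Jc.
have cX : c ^+ x = 1.
  apply/set1P; rewrite -Ju; apply: codeJ_diff_sub Jc _ => [j|].
    by rewrite -eX !hammingX => ->.
  exact: groupX.
(* If [c i = 1], then [c ^+ x] has the nonzero value [u i] at [i], against [cX]. *)
have c_i : e i != c i.
  apply: contraNneq u_i => ec; move/ffunP/(_ i): cX.
  by rewrite hammingX -ec -hammingX eX hamming1 => ->.
have c_off j : j != i -> c j = 0%R.
  move: Jc; rewrite in_codeJ => /andP[/card_le1_eqP le1 _] ji.
  apply: contraNeq (ji) => c_j.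
  by apply/eqP/le1; rewrite inE // eE (negbTE ji) eq_sym.
case/negP: c_neq1; rewrite -in_set1 -Ju in_codeJ Cc andbT.
rewrite -(cards1 i); apply/subset_leq_card/subsetP => j; rewrite !inE.
by apply: contraNT => ji; rewrite u_off // c_off.
Qed.

Lemma codeJ_card1 u : #|J u| = 1%N -> u \in C.
Proof.
move=> /eqP/cards1P[a Ju].
have Ca : a \in C by apply: (@codeJ_sub u); rewrite Ju set11.
(* Translation by [a^-1] moves the only codeword of [J u] to [1], so [a^-1 * u = 1]. *)
rewrite -(groupMl u (groupVr Ca)) (@codeJ_eq1 (a^-1 * u)) //.
apply/setP => v; rewrite codeJ_translate ?groupV // invgK Ju !inE.
by rewrite -{2}[a]mulg1 (inj_eq (mulgI a)).
Qed.

End HammingGroupCode.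

Theorem theorem3p7 (n : nat) (m : 'I_n -> nat) (C : {set hammingV m})
    (hn : 3 <= n) (hm : forall i, 3 <= m i)
    (hC : group_identifying_code C) :
  (forall u : hammingV m, #|codeJ (@hamming_adj n m) C u| <> 2) /\
  (forall u : hammingV m, u \notin C -> 3 <= #|codeJ (@hamming_adj n m) C u|).
Proof.
case: hC => gC [J0 Jinj]; have neq2 := @codeJ_neq2 n m (Group gC) Jinj.
split=> [|u Cu]; first exact: neq2.
(* Sizes 0, 1 and 2 are excluded by [J0], [codeJ_card1] and [neq2]. *)
have := neq2 u; have := @codeJ_card1 n m (Group gC) Jinj hm u.
have := J0 u; rewrite -cards_eq0 /=.
by case: #|_| => [|[|[|p]]] // _ /(_ erefl); rewrite (negbTE Cu).
Qed.
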